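(* Let $P\subset\mathbb{R}^n$ be the intersection of an affine subspace of $\mathbb{R}^n$ with the non-negative orthant $\mathbb{R}^n_+$. Suppose $P$ is bounded and has non-empty interior (i.e. contains a point with all coordinates strictly positive). Then the strictly concave function $f(x)=n+\sum_{j=1}^n\ln\xi_j$, $x=(\xi_1,\dots,\xi_n)$, attains its unique maximum on $P$ at a point $z=(\zeta_1,\dots,\zeta_n)$ with $\zeta_j>0$ for $j=1,\dots,n$. Moreover, if $x_1,\dots,x_n$ are independent exponential random variables with $\mathbf{E}\,x_j=\zeta_j$ and $X=(x_1,\dots,x_n)$, then the density of $X$ is constant on $P$ and equals $e^{-f(z)}$ at every $x\in P$.
   Context: An exponential random variable with expectation $\zeta>0$ has density $\zeta^{-1}e^{-\tau/\zeta}$ for $\tau\ge0$ and $0$ for $\tau<0$. The density of $X$ is the product density on $\mathbb{R}^n$. *)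

(* Defs.v *)
From HB Require Import structures.
From mathcomp Require Import all_boot all_order all_algebra.
From mathcomp Require Import all_classical all_reals all_analysis.

Set Implicit Arguments.
Unset Strict Implicit.
Unset Printing Implicit Defensive.

Import Order.TTheory GRing.Theory Num.Theory.
Import numFieldNormedType.Exports.

Local Open Scope classical_set_scope.
Local Open Scope ring_scope.

Section geometry.
Context {R : realType} {n : nat}.
Implicit Types (A : set 'rV[R]_n) (f : 'rV[R]_n -> \bar R).

Definition affine_subspace A :=
  exists (a : 'rV[R]_n) (U : {vspace 'rV[R]_n}), A = [set x | x - a \in U].

Definition nonneg_orthant : set 'rV[R]_n := [set x | forall j, 0 <= x ord0 j].

Definition pos_orthant : set 'rV[R]_n := [set x | forall j, 0 < x ord0 j].

Definition maximizers A f : set 'rV[R]_n :=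
  [set x | A x /\ forall y, A y -> (f y <= f x)%E].

Definition strictly_concave_on A f :=
  forall x y (t : R), A x -> A y -> x != y -> 0 < t -> t < 1 ->
    (t%:E * f x + (1 - t)%:E * f y < f (t *: x + (1 - t) *: y)%R)%E.

(* [lne] is [-oo] on nonpositive reals (whereas the real-valued [ln] is 0
   there), so [entropy x = -oo] as soon as some coordinate of [x] vanishes. *)
Definition entropy (x : 'rV[R]_n) : \bar R :=
  (n%:R%:E + \sum_(j < n) lne (x ord0 j)%:E)%E.

End geometry.
Arguments nonneg_orthant {R} n.
Arguments pos_orthant {R} n.

Section lebesgue_tuple.
Context {R : realType}.

(* [pushforward m f] is a measure only when [f] is measurable; the proof cannot
   be inferred from [f], so it is an explicit argument here. *)
Definition pushforward_measure d d' (T1 : measurableType d)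
    (T2 : measurableType d') (m : {measure set T1 -> \bar R}) (f : T1 -> T2)
    (mf : measurable_fun [set: T1] f) : {measure set T2 -> \bar R} :=
  @measure_function_pushforward__canonical__measure_function_Measure
    _ _ _ _ _ m f mf.

Definition tuple_cons n (p : n.-tuple R * R) : n.+1.-tuple R :=
  [tuple of p.2 :: p.1].

Lemma measurable_tuple_cons n :
  measurable_fun [set: n.-tuple R * R] (@tuple_cons n).
Proof.
exact: (@measurable_cons _ _ _ _ snd n fst measurable_snd measurable_fst).
Qed.

(* Lebesgue measure on R^n, as the n-fold product of [lebesgue_measure]. *)
Fixpoint lebesgue_tuple n : {measure set (n.-tuple R) -> \bar R} :=
  match n with
  | 0 => \d_([tuple] : 0.-tuple R)
  | m.+1 => pushforward_measure
      (lebesgue_tuple m \x lebesgue_measure)%E (@measurable_tuple_cons m)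
  end.

End lebesgue_tuple.

Section random_vectors.
Context d {T : measurableType d} {R : realType} (Pr : probability T R).

(* [exponential_prob] takes the rate, i.e. the inverse of the expectation
   [zeta]: its density is [zeta^-1 * expR (- x / zeta)] for [x >= 0]. *)
Definition exponential_rv (Y : {RV Pr >-> R}) :=
  exists2 zeta : R, 0 < zeta &
    forall B : set R, measurable B ->
      distribution Pr Y B = exponential_prob zeta^-1 B.

Context {n : nat}.
Implicit Type X : 'I_n -> {RV Pr >-> R}.

Definition independent_rvs X :=
  forall (J : {set 'I_n}) (B : 'I_n -> set R),
    (forall j, measurable (B j)) ->
    Pr (\bigcap_(j in [set` J]) (X j @^-1` B j))
      = (\prod_(j in J) Pr (X j @^-1` B j))%E.

Definition random_vector X (w : T) : n.-tuple R := [tuple X j w | j < n].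

(* [g] is a density, with respect to Lebesgue measure on R^n, of the law of
   the random vector [X]. *)
Definition has_joint_density X (g : 'rV[R]_n -> R) :=
  let g' (t : n.-tuple R) := g (\row_j tnth t j) in
  [/\ forall x, 0 <= g x,
      measurable_fun [set: n.-tuple R] g' &
      forall B : set (n.-tuple R), measurable B ->
        Pr (random_vector X @^-1` B)
          = (\int[lebesgue_tuple n]_(t in B) (g' t)%:E)%E].

End random_vectors.

(* Densities are only determined almost everywhere; "the density" of a vector
   of independent exponential variables with expectations [z] is this one. *)
Definition exponential_joint_pdf {R : realType} {n : nat}
    (z x : 'rV[R]_n) : R :=
  \prod_(j < n) exponential_pdf (z ord0 j)^-1 (x ord0 j).

(* Main.v *)
(* Existence of the maximum point z is obtained from the continuous function
   prod_j xi_j, whose maximum on the compact set P is positive; its uniqueness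
   from strict concavity.  Since z has positive coordinates, for x in P the
   line through z and x stays in P near z, and the vanishing of the derivative
   of f along it at z reads sum_j xi_j / zeta_j = n.  Hence the product density
   prod_j zeta_j^-1 exp(- xi_j / zeta_j) equals
   exp(- n - sum_j ln zeta_j) = exp(- f z) at every x in P.
   That it is a density of X follows by comparing, with Fubini, the law of X and
   the measure with this density on boxes, which form a generating pi-system. *)
Require Import Defs.
From HB Require Import structures.
From mathcomp Require Import all_boot all_order all_algebra.
From mathcomp Require Import all_classical all_reals all_analysis.
From mathcomp Require Import measurable_realfun ring lra.

Set Implicit Arguments.
Unset Strict Implicit.
Unset Printing Implicit Defensive.

Import Order.TTheory GRing.Theory Num.Theory.
Import numFieldNormedType.Exports.

Local Open Scope classical_set_scope.
Local Open Scope ring_scope.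

(** * Strict concavity of the logarithm *)

(** This is [1 + y < expR y] for [y != 0], taken at [y = ln x]. *)
Lemma ln_lt_subr1 (R : realType) (x : R) : 0 < x -> x != 1 -> ln x < x - 1.
Proof.
move=> x0 x1; have lnx0 : ln x != 0.
  by apply: contra_neq x1 => lnx; rewrite -(lnK x0) lnx expR0.
by have := expR_gt1Dx lnx0; rewrite lnK ?posrE// ltrBrDl.
Qed.

Lemma ln_le_subr1 (R : realType) (x : R) : 0 < x -> ln x <= x - 1.
Proof.
move=> x0; have [->|x1] := eqVneq x 1; first by rewrite ln1 subrr.
exact/ltW/ln_lt_subr1.
Qed.

(* Both logarithms are compared with the tangent of [ln] at the barycentre
   [c = t a + (1 - t) b]. *)
Lemma ln_concave (R : realType) (a b t : R) : 0 < a -> 0 < b -> 0 < t < 1 ->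
  t * ln a + (1 - t) * ln b <= ln (t * a + (1 - t) * b)
    ?= iff (a == b).
Proof.
move=> a0 b0 /andP[t0 t1]; have u0 : 0 < 1 - t by rewrite subr_gt0.
have c0 : 0 < t * a + (1 - t) * b by rewrite addr_gt0// mulr_gt0.
set c := _ + _ * b in c0 *; apply/leifP.
have [eab|ab] := eqVneq a b.
  by rewrite /c -eab -!mulrDl !(addrC t) subrK !mul1r.
have ac1 : a / c != 1.
  apply: contra_neq ab => /divr1_eq ac; apply: (mulfI (lt0r_neq0 u0)).
  by move: ac; rewrite /c; lra.
have := ln_lt_subr1 (divr_gt0 a0 c0) ac1; rewrite -(ltr_pM2l t0).
have := ln_le_subr1 (divr_gt0 b0 c0); rewrite -(ler_pM2l u0).
rewrite !ln_div ?posrE//.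
have : t * (a / c) + (1 - t) * (b / c) = 1.
  by rewrite !mulrA -mulrDl divff// gt_eqF.
by lra.
Qed.

(** * Topology: closedness of the constraints, continuity of the product *)

(** Membership of [x - a] in [U] means that the residual of its projection onto [U] vanishes, a
    closed condition on each coordinate. *)
Lemma closed_affine_subspace (R : realType) n (A : set 'rV[R]_n) :
  affine_subspace A -> closed A.
Proof.
move=> [a [U ->]]; pose L v := v - projv U v.
have -> : [set x | x - a \in U] =
    \bigcap_(j in [set: 'I_n]) ((fun x => L (x - a) ord0 j) @^-1` [set 0]).
  apply/seteqP; split=> x /=.
    by move=> xU j _ /=; rewrite /L projv_id// subrr mxE.
  move=> Lx; have /eqP : L (x - a) = 0.
    by apply/rowP => j; rewrite [RHS]mxE; exact: (Lx j).
  by rewrite subr_eq0 => /eqP ->; exact: memv_proj.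
apply: closed_bigI => j _.
apply: preimage_closed => [x _|]; last exact: closed_eq.
(* Expanding in the standard basis reduces continuity of the linear map [L] to that of the
   coordinates. *)
have -> : (fun x => L (x - a) ord0 j) =
    (fun x : 'rV[R]_n =>
      \sum_i (x ord0 i - a ord0 i) * L (delta_mx 0 i) ord0 j).
  apply/funext => y; rewrite {1}(row_sum_delta (y - a)) /L linear_sum/=.
  rewrite -sumrB summxE; apply: eq_bigr => i _.
  by rewrite linearZ/= -scalerBr !mxE.
apply: continuous_big => [|i _].
  by move=> [y1 y2]; apply: cvgD; [exact: cvg_fst | exact: cvg_snd].
move=> z; apply: (@continuous_comp _ _ _ (fun x : 'rV[R]_n => x ord0 i)
    (fun y => (y - a ord0 i) * L (delta_mx 0 i) ord0 j)).
  exact: coord_continuous.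
by apply: cvgM; [apply: cvgB; [exact: cvg_id|exact: cvg_cst]|exact: cvg_cst].
Qed.

Lemma closed_nonneg_orthant (R : realType) n : closed (@nonneg_orthant R n).
Proof.
have -> : nonneg_orthant n = \bigcap_(j in [set: 'I_n])
    ((fun x : 'rV[R]_n => x ord0 j) @^-1` [set y | 0 <= y]).
  by apply/seteqP; split=> x /= xP j; [move=> _|]; exact: xP.
apply: closed_bigI => j _; apply: preimage_closed => [x _|].
  exact: coord_continuous.
exact: closed_ge.
Qed.

Lemma continuous_prod_coord (R : realType) n :
  continuous (fun x : 'rV[R]_n => \prod_j x ord0 j).
Proof.
apply: continuous_big => [|i _].
  by move=> [y1 y2]; apply: cvgM; [exact: cvg_fst | exact: cvg_snd].
exact: coord_continuous.
Qed.

(** * The function f and its strict concavity *)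

Lemma entropy_pos (R : realType) n (x : 'rV[R]_n) : pos_orthant n x ->
  entropy x = (n%:R + \sum_j ln (x ord0 j))%:E.
Proof.
move=> x0; rewrite /entropy EFinD -sumEFin; congr (_ + _)%E.
by apply: eq_bigr => j _; rewrite lne_EFin.
Qed.

Lemma entropy_Ny (R : realType) n (x : 'rV[R]_n) j : x ord0 j <= 0 ->
  entropy x = -oo%E.
Proof.
move=> xj0; rewrite /entropy (bigD1 j)//= xj0 addNye addeNy//.
Qed.

(** Concavity of [ln] is summed over the coordinates; it is strict at a coordinate where [x] and [y]
    differ. *)
Lemma strictly_concave_entropy (R : realType) n :
  strictly_concave_on (pos_orthant n) (@entropy R n).
Proof.
move=> x y t x0 y0 xy t0 t1; have u0 : 0 < 1 - t by rewrite subr_gt0.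
have t01 : 0 < t < 1 by rewrite t0.
have xy0 : pos_orthant n (t *: x + (1 - t) *: y).
  by move=> j; rewrite !mxE addr_gt0// mulr_gt0.
rewrite !entropy_pos// -!EFinM -EFinD lte_fin.
rewrite !mulrDr addrACA -mulrDl (addrC t) subrK mul1r ltrD2l.
have [j xyj] : exists j, x ord0 j != y ord0 j.
  apply/existsP; apply: contra_neqT xy; rewrite negb_exists => /forallP xy.
  by apply/rowP => j; apply/eqP; have := xy j; rewrite negbK.
rewrite !mulr_sumr -big_split/=.
rewrite (bigD1 j)//= [ltRHS](bigD1 j)//= !mxE; apply: ltr_leD.
  by rewrite (lt_leif (ln_concave (x0 j) (y0 j) t01)).
by apply: ler_sum => i _; rewrite !mxE (ln_concave (x0 i) (y0 i) t01).
Qed.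

(** * The maximum point and its first-order condition *)

Lemma exists_max_prod (R : realType) n (P : set 'rV[R]_n) :
  P !=set0 -> compact P ->
  exists2 z, P z & forall x, P x -> \prod_j x ord0 j <= \prod_j z ord0 j.
Proof.
move=> P0 cP; have /(EVT_max_rV P0 cP)[z zP zmax] :
    {within P, continuous (fun x : 'rV[R]_n => \prod_j x ord0 j)}.
  exact/continuous_subspaceT/continuous_prod_coord.
by exists z => [|x /mem_set/zmax//]; exact: set_mem.
Qed.

(** Every factor equals 1 at 0, so the product rule leaves only the derivatives [u i]. *)
Lemma deriv_prod1DX0 (R : comNzRingType) (I : Type) (r : seq I) (u : I -> R) :
  (\prod_(i <- r) (1 + (u i)%:P * 'X))^`().[0] = \sum_(i <- r) u i.
Proof.
elim: r => [|i r IHr]; first by rewrite !big_nil derivC hornerC.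
rewrite !big_cons derivM derivD derivM !derivC derivX !(hornerD, hornerM) IHr.
rewrite !hornerE horner_prod big1 => [|k _]; last by rewrite !hornerE.
by rewrite /= !add0r mulr1.
Qed.

(* [t |-> prod_j (z + t (x - z))_j / z_j] is a polynomial with value 1 and
   derivative [sum_j (x_j / z_j - 1)] at 0; as [z] is positive, the segment can
   be extended beyond [z] inside [P], so that 0 is an interior maximum. *)
Lemma max_prod_sum_ratio (R : realType) n (A : set 'rV[R]_n) (z x : 'rV[R]_n) :
  affine_subspace A -> A z -> pos_orthant n z ->
  (forall y, A y -> nonneg_orthant n y ->
    \prod_j y ord0 j <= \prod_j z ord0 j) ->
  A x -> \sum_j x ord0 j / z ord0 j = n%:R.
Proof.
move=> [a [U AE]] Az z0 zmax Ax.
pose u j := x ord0 j / z ord0 j - 1.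
suff : \sum_j u j = 0.
  by rewrite sumrB sumr_const card_ord => /eqP; rewrite subr_eq0 => /eqP.
pose p : {poly R} := \prod_j (1 + (u j)%:P * 'X).
have pE t : p.[t] = \prod_j (1 + u j * t).
  by rewrite horner_prod; apply: eq_bigr => j _; rewrite !hornerE.
(* For [|t| < e] every [|u j * t|] is at most 1, which keeps the point [y] below in the orthant; the
   summand 1 keeps the denominator positive. *)
pose e := (1 + \sum_j `|u j|)^-1.
have su0 : 0 <= \sum_j `|u j| by exact: sumr_ge0.
have e0 : 0 < e by rewrite invr_gt0 ltr_wpDr.
have pmax t : t \in `](- e), e[ -> p.[t] <= p.[0].
  rewrite in_itv/= -ltr_norml => te.
  rewrite [leRHS]pE [leRHS]big1 => [|j _]; last by rewrite mulr0 addr0.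
  pose y := z + t *: (x - z).
  have yE j : y ord0 j = z ord0 j * (1 + u j * t).
    by rewrite /u !mxE; field; rewrite gt_eqF// z0.
  have Ay : A y.
    move: Az Ax; rewrite AE /= => Az Ax.
    have -> : y - a = (z - a) + t *: ((x - a) - (z - a)).
      by rewrite opprB addrA subrK /y addrAC.
    by rewrite memvD// memvZ// memvB.
  have y0 : nonneg_orthant n y.
    move=> j; rewrite yE mulr_ge0 ?(ltW (z0 j))//.
    suff : `|u j * t| <= 1 by rewrite ler_norml; lra.
    rewrite normrM (le_trans (ler_wpM2l _ (ltW te)))//.
    rewrite ler_pdivrMr ?ltr_wpDr// mul1r (bigD1 j)//=.
    by rewrite addrCA lerDl addr_ge0// sumr_ge0.
  (* Dividing by the positive product of the [z ord0 j] turns maximality of [z] into [p.[t] <=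
     1]. *)
  have := zmax _ Ay y0; under eq_bigr do rewrite yE.
  rewrite big_split/= -pE -[leRHS]mulr1 ler_pM2l//.
  by apply: prodr_gt0 => j _; exact: z0.
have dp0 : is_derive (0 : R) (1 : R) (horner p) 0.
  apply: (@derive1_at_max _ _ (- e) e); rewrite ?in_itv/= ?oppr_lt0 ?e0//.
  by rewrite (le_trans _ (ltW e0))// oppr_le0 ltW.
have /= dp := @derive_val _ _ _ _ _ _ _ dp0.
by rewrite -deriv_prod1DX0 -/p derivE derive1E.
Qed.

Lemma entropy_maximizer (R : realType) n (A : set 'rV[R]_n) :
  affine_subspace A -> bounded_set (A `&` nonneg_orthant n) ->
  (exists x, (A `&` nonneg_orthant n) x /\ pos_orthant n x) ->
  exists z : 'rV[R]_n,
    [/\ maximizers (A `&` nonneg_orthant n) (@entropy R n) = [set z],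
        pos_orthant n z &
        forall x, A x -> \sum_j x ord0 j / z ord0 j = n%:R].
Proof.
move=> affA; set P := A `&` _ => bP [x1 [Px1 x1_gt0]].
have cP : compact P.
  apply: bounded_closed_compact => //; apply: closedI.
    exact: closed_affine_subspace.
  exact: closed_nonneg_orthant.
have [|z Pz zmax] := @exists_max_prod R n P _ cP; first by exists x1.
have prodz0 : 0 < \prod_j z ord0 j.
  by rewrite (lt_le_trans _ (zmax _ Px1))// prodr_gt0// => j _; exact: x1_gt0.
have z0 : pos_orthant n z.
  move=> j; have := Pz.2 j; rewrite le_eqVlt => /predU1P[zj0|//].
  by move: prodz0; rewrite (bigD1 j)//= -zj0 mul0r ltxx.
(* On positive points, exponentiating turns entropies into products, where [zmax] applies; at the
   other points of [P] the entropy is [-oo]. *)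
have Pmax x : P x -> (entropy x <= entropy z)%E.
  move=> Px; have [/forallP x0|] := boolP [forall j, 0 < x ord0 j].
    rewrite !entropy_pos// lee_fin lerD2l -ler_expR !expR_sum.
    by under eq_bigr do rewrite lnK ?posrE//;
       under [leRHS]eq_bigr do rewrite lnK ?posrE//; exact: zmax.
  rewrite negb_forall => /existsP[j]; rewrite -leNgt => xj0.
  by rewrite (entropy_Ny xj0) leNye.
exists z; split=> // [|x Ax].
  apply/seteqP; split=> [y [Py ymax]|_ ->//]; apply: contrapT => /eqP yz.
  (* A maximizer has entropy at least the finite [entropy z], so none of its coordinates
     vanishes. *)
  have y0 : pos_orthant n y.
    move=> j; rewrite ltNge; apply/negP => yj0.
    by have := ymax _ Pz; rewrite (entropy_Ny yj0) entropy_pos.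
  (* The midpoint of two distinct maximizers lies in [P] and, by strict concavity, would exceed the
     maximum. *)
  have h0 : (0 : R) < 2^-1 by [].
  have h1 : (2^-1 : R) < 1 by rewrite invf_lt1// ltr1n.
  have := strictly_concave_entropy y0 z0 yz h0 h1.
  have <- : entropy z = entropy y.
    by apply/eqP; rewrite eq_le (Pmax _ Py) (ymax _ Pz).
  have Pm : P (2^-1 *: y + (1 - 2^-1) *: z).
    split; last first.
      move=> j; rewrite !mxE addr_ge0// mulr_ge0// ?subr_ge0 ?(ltW h1)//.
        by case: Py.
      by case: Pz.
    case: affA => a [U AE]; case: Py Pz => + _ [+ _].
    rewrite AE /= => yU zU.
    have -> : 2^-1 *: y + (1 - 2^-1) *: z - a =
        2^-1 *: (y - a) + (1 - 2^-1) *: (z - a).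
      by rewrite !scalerBr addrACA -opprD -scalerDl subrKC scale1r.
    by rewrite memvD// memvZ.
  move=> /lt_le_trans/(_ (Pmax _ Pm)).
  by rewrite entropy_pos// -!EFinM -EFinD -mulrDl subrKC mul1r ltxx.
apply: (max_prod_sum_ratio affA _ z0 _ Ax); first by case: Pz.
by move=> y Ay y0; apply: zmax.
Qed.

(** * Exponential densities, tails and expectations *)

Lemma exponential_joint_pdf_sum_ratio (R : realType) n (z x : 'rV[R]_n) :
  pos_orthant n z -> nonneg_orthant n x ->
  \sum_j x ord0 j / z ord0 j = n%:R ->
  (exponential_joint_pdf z x)%:E = expeR (- entropy z)%E.
Proof.
(* Replacing [n] by the sum of ratios makes the right-hand exponent a sum over [j], so the two
   products agree factor by factor. *)
move=> z0 x0 xz; rewrite entropy_pos//= opprD -xz -!sumrN -big_split/= expR_sum.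
congr (_%:E); apply: eq_bigr => j _.
rewrite exponential_pdfE ?x0// expRD mulrC (expRN (ln _)) lnK ?posrE//.
by rewrite mulNr (mulrC (x _ _)).
Qed.

(** The function [- expR (- r * y)] is an antiderivative of the density and tends to 0 at
    infinity. *)
Lemma exponential_prob_itvcy (R : realType) (r x : R) : 0 < r -> 0 <= x ->
  exponential_prob r `]x, +oo[ = (expR (- r * x))%:E.
Proof.
move=> r0 x0; rewrite /exponential_prob integral_itv_obnd_cbnd//; last first.
  by apply/measurable_EFinP/measurable_funTS; exact: measurable_exponential_pdf.
have cexp : continuous (fun y : R => expR (- r * y)).
  move=> y; apply: continuous_comp; last exact: continuous_expR.
  exact: mulrl_continuous.
rewrite (@ge0_continuous_FTC2y _ _ (fun y => - expR (- r * y)) _ 0)//.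
- by rewrite EFinN oppeK add0e.
- by move=> y _; apply: exponential_pdf_ge0; exact: ltW.
- apply: (@continuous_subspaceW R^o _ _ `[0, +oo[); last first.
    exact: within_continuous_exponential_pdf.
  by apply: subset_itvr; rewrite bnd_simp.
- rewrite -oppr0; apply: cvgN.
  rewrite (_ : (fun y => expR (- r * y)) =
               (fun y => expR (- y)) \o (fun y => r * y)).
    apply: (@cvg_comp _ _ _ _ _ _ (pinfty_nbhs R)); last exact: cvgr_expR.
    exact: gt0_cvgMry.
  by apply: eq_fun => y; rewrite mulNr.
- by apply: cvgN; apply/cvg_at_right_filter; exact: cexp.
- move=> y; rewrite in_itv/= andbT => xy; apply: derive1_exponential_pdf.
  by rewrite in_itv/= andbT (le_lt_trans x0).
Qed.

Section exponential_expectation.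
Context d {T : measurableType d} {R : realType} (Pr : probability T R).

(** Identifies the parameter hidden in [exponential_rv] with the expectation. The expectation is
    computed as the integral of the tail, which is [zeta] times the density and hence has integral
    [zeta]. *)
Lemma expectation_exponential (Y : {RV Pr >-> R}) (zeta : R) : 0 < zeta ->
  (forall B : set R, measurable B ->
    distribution Pr Y B = exponential_prob zeta^-1 B) ->
  ('E_Pr[Y] = zeta%:E)%E.
Proof.
move=> z0 Yexp; have r0 : 0 < zeta^-1 by rewrite invr_gt0.
(* [Y] may be negative on a null set, while the tail formula requires a nonnegative variable; the
   tail of the negative part turns out to be 0. *)
pose Yp : {RV Pr >-> R} := Y^\+%R.
pose Yn : {RV Pr >-> R} := Y^\-%R.
have -> : ('E_Pr[Y] = 'E_Pr[Yp] - 'E_Pr[Yn])%E.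
  rewrite !expectation_def integralE; congr (_ - _)%E.
    by apply: eq_integral => w _; rewrite funeposE EFin_max.
  by apply: eq_integral => w _; rewrite funenegE EFin_max.
rewrite (@ge0_expectation_ccdf _ _ _ _ Yn) => [|w]; last exact: funrneg_ge0.
rewrite [X in (_ - X)%E]integral0_eq ?sube0 => [|x]; last first.
  rewrite /= in_itv/= andbT => x0.
  rewrite /ccdf /distribution /pushforward.
  have -> : Yn @^-1` `]x, +oo[ = Y @^-1` `]-oo, (- x)[.
    apply/seteqP; split=> w /=; rewrite !in_itv/= andbT lt_max ltrNr.
      by move=> /orP[//|]; rewrite ltNge x0.
    by move=> ->.
  have := Yexp _ (measurable_itv `]-oo, (- x)[).
  rewrite /distribution /pushforward => ->.
  apply: integral0_eq => y /=; rewrite in_itv/= => yx.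
  by rewrite lt0_exponential_pdf// (lt_le_trans yx)// oppr_le0.
rewrite ge0_expectation_ccdf => [|w]; last exact: funrpos_ge0.
under eq_integral => x.
  rewrite inE/= in_itv/= andbT => x0.
  have -> : ccdf Yp x = (zeta%:E * (exponential_pdf zeta^-1 x)%:E)%E.
    rewrite exponential_pdfE// -EFinM mulrA divff ?gt_eqF// mul1r.
    rewrite -exponential_prob_itvcy// -Yexp// /ccdf /distribution /pushforward.
    congr (Pr _); apply/seteqP; split=> w /=; rewrite !in_itv/= !andbT lt_max.
      by move=> /orP[//|]; rewrite ltNge x0.
    by move=> ->.
  over.
rewrite ge0_integralZl//=; last 3 first.
- by apply/measurable_EFinP/measurable_funTS; exact: measurable_exponential_pdf.
- by move=> x _; rewrite lee_fin exponential_pdf_ge0// ltW.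
- by rewrite lee_fin ltW.
rewrite -integral_itv_obnd_cbnd//; last first.
  by apply/measurable_EFinP/measurable_funTS; exact: measurable_exponential_pdf.
(* The tail at 0 gives the total mass 1 of the density. *)
have := exponential_prob_itvcy r0 (lexx 0).
by rewrite /exponential_prob mulr0 expR0 => ->; rewrite mule1.
Qed.

End exponential_expectation.

(** * Boxes and iterated integration for Lebesgue measure on R^n *)

(* [fubini_tonelli1] for a first measure whose sigma-finiteness is only known
   as a proposition, as for the recursively defined [lebesgue_tuple]. *)
Lemma fubini_tonelli1_sigma_finite d1 d2 (T1 : measurableType d1)
    (T2 : measurableType d2) (R : realType) (m1 : {measure set T1 -> \bar R})
    (m2 : {sigma_finite_measure set T2 -> \bar R}) (f : T1 * T2 -> \bar R) :
  sigma_finite setT m1 -> measurable_fun setT f -> (forall x, 0 <= f x)%E ->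
  (\int[m1 \x m2]_z f z = \int[m1]_x \int[m2]_y f (x, y))%E.
Proof.
move=> sf mf f0.
pose h1 := isSFinite.Build _ _ _ _ (sfinite_measure_sigma_finite sf).
pose h2 := isSigmaFinite.Build _ _ _ _ sf.
pose m1' := HB.pack_for (SigmaFiniteMeasure.type T1 R) (Measure.sort m1) h1 h2.
exact: (fubini_tonelli1 (m1 := m1') (m2 := m2) f mf f0).
Qed.

Section boxes.
Context {R : realType}.

Definition box n (B : 'I_n -> set R) : set (n.-tuple R) :=
  [set t | forall i, B i (tnth t i)].

Lemma boxE n (B : 'I_n -> set R) :
  box B = \bigcap_(i in [set: 'I_n]) ((@tnth n R ^~ i) @^-1` B i).
Proof. by apply/seteqP; split=> t /= tB i; [move=> _|]; exact: tB. Qed.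

Lemma boxT n : box (fun=> setT) = [set: n.-tuple R].
Proof. by apply/seteqP; split. Qed.

Lemma measurable_box n (B : 'I_n -> set R) :
  (forall i, measurable (B i)) -> measurable (box B).
Proof.
move=> mB; rewrite boxE; apply: fin_bigcap_measurable => // i _.
by rewrite -[_ @^-1` _]setTI; apply: measurable_tnth.
Qed.

(** A generating coordinate preimage is a box with all sides but one equal to the whole line;
    conversely boxes are measurable. *)
Lemma tuple_measurableE n : @measurable _ (n.-tuple R) =
  <<s [set box B | B in [set B : 'I_n -> set R | forall i, measurable (B i)]] >>.
Proof.
apply/seteqP; split.
  rewrite [X in X `<=` _]/measurable/= /g_sigma_preimage.
  apply: (smallest_sub (smallest_sigma_algebra _ _)).
  move=> C; rewrite -bigcup_seq => -[i _ [D mD]]; rewrite setTI => <-.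
  apply: sub_sigma_algebra; exists (fun j => if j == i then D else setT).
    by move=> j; case: ifP.
  apply/seteqP; split=> t /=; first by move=> /(_ i); rewrite eqxx.
  by move=> Dt j; case: eqP => // ->.
apply: smallest_sub; first exact: sigma_algebra_measurable.
by move=> _ [B mB <-]; exact: measurable_box.
Qed.

Lemma preimage_tuple_cons_box n (B : 'I_n.+1 -> set R) :
  @tuple_cons R n @^-1` box B = box (fun i => B (lift ord0 i)) `*` B ord0.
Proof.
apply/seteqP; split=> -[t x] /=.
  move=> Btx; split=> [i|]; last by have := Btx ord0; rewrite tnth0.
  by have := Btx (lift ord0 i); rewrite tnthS.
move=> [Bt Bx] i; case: (unliftP ord0 i) => [j|] ->; last by rewrite tnth0.
by rewrite tnthS; exact: Bt.
Qed.

Lemma lebesgue_tuple_box n (B : 'I_n -> set R) :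
  (forall i, measurable (B i)) ->
  lebesgue_tuple n (box B) = (\prod_i lebesgue_measure (B i))%E.
Proof.
elim: n B => [|n IHn] B mB.
  by rewrite big_ord0/= diracE mem_set// => -[].
have mB' i : measurable (B (lift ord0 i)) by exact: mB.
rewrite /= /pushforward preimage_tuple_cons_box product_measure1E.
- by rewrite IHn// big_ord_recl muleC.
- exact: measurable_box.
- exact: mB.
Qed.

Lemma sigma_finite_lebesgue_tuple n :
  sigma_finite [set: n.-tuple R] (@lebesgue_tuple R n).
Proof.
exists (fun k => box (fun=> [set` `[- k%:R, k%:R]])).
  apply/seteqP; split=> // t _.
  (* The sum of absolute values bounds every coordinate, so the cube of this half-width contains
     [t]. *)
  exists (Num.truncn (\sum_i `|tnth t i|)).+1 => // i /=.
  rewrite in_itv/= -ler_norml ltW//.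
  rewrite (le_lt_trans _ (truncnS_gt _))//.
  by rewrite (bigD1 i)//= lerDl sumr_ge0.
move=> k; split; first exact: measurable_box.
rewrite lebesgue_tuple_box//.
have [r ->] : exists r : R, lebesgue_measure [set` `[- k%:R, (k%:R : R)]] = r%:E.
  rewrite lebesgue_measure_itv/=; case: ifP => _; last by exists 0.
  by exists (k%:R - - k%:R).
by rewrite prodEFin ltry.
Qed.

(** Induction on [n]: transport along [tuple_cons], then Tonelli splits off the factor of the first
    coordinate. *)
Lemma integral_prod_lebesgue_tuple n (f : 'I_n -> R -> R) :
  (forall i x, 0 <= f i x) -> (forall i, measurable_fun setT (f i)) ->
  (\int[lebesgue_tuple n]_t (\prod_i f i (tnth t i))%:E =
   \prod_i \int[lebesgue_measure]_x (f i x)%:E)%E.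
Proof.
have mprod m (h : 'I_m -> R -> R) : (forall i, measurable_fun setT (h i)) ->
    measurable_fun [set: m.-tuple R] (fun t => (\prod_i h i (tnth t i))%:E).
  move=> mh; apply/measurable_EFinP; apply: measurable_prod => i _.
  apply: (measurableT_comp (mh i)); exact: measurable_tnth.
elim: n f => [|n IHn] f f0 mf.
  rewrite big_ord0 integral_dirac => [||]; [|exact: measurableT|exact: mprod].
  by rewrite diracT mul1e big_ord0.
have mf' i : measurable_fun setT (f (lift ord0 i)) by exact: mf.
have prod0 (t : n.-tuple R) : 0 <= \prod_i f (lift ord0 i) (tnth t i).
  by apply: prodr_ge0 => i _.
have int0 : (0 <= \int[lebesgue_measure]_x (f ord0 x)%:E)%E.
  by apply: integral_ge0 => x _; rewrite lee_fin.
have intZ : (\int[lebesgue_tuple n]_t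
    ((\prod_i f (lift ord0 i) (tnth t i))%:E *
     \int[lebesgue_measure]_x (f ord0 x)%:E) =
    \prod_i \int[lebesgue_measure]_x (f i x)%:E)%E.
  rewrite ge0_integralZr//.
  - by rewrite (IHn (fun i => f (lift ord0 i)))// big_ord_recl muleC.
  - exact: (mprod _ (fun i => f (lift ord0 i))).
  - by move=> t _; rewrite lee_fin.
transitivity (\int[(lebesgue_tuple n \x lebesgue_measure)%E]_p
    ((\prod_i f i (tnth (tuple_cons p) i))%:E))%E.
  rewrite ge0_integral_pushforward//.
  - exact: measurable_tuple_cons.
  - exact: mprod.
  - by move=> t _; rewrite lee_fin prodr_ge0.
rewrite fubini_tonelli1_sigma_finite/=; last 3 first.
- exact: sigma_finite_lebesgue_tuple.
- apply: (measurableT_comp (mprod _ _ mf)); exact: measurable_tuple_cons.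
- by move=> p; rewrite lee_fin prodr_ge0.
rewrite -intZ; apply: eq_integral => t _.
rewrite -ge0_integralZl//; last 3 first.
- by apply/measurable_EFinP; exact: mf.
- by move=> x _; rewrite lee_fin.
- by rewrite lee_fin.
apply: eq_integral => x _; rewrite big_ord_recl tnth0 -EFinM mulrC.
by congr (_ * _)%:E; apply: eq_bigr => i _; rewrite tnthS.
Qed.

(** The indicator of a box is a product of indicators, so each [f i] can be replaced by its
    restriction to [B i]. *)
Lemma integral_lebesgue_tuple_box n (f : 'I_n -> R -> R) (B : 'I_n -> set R) :
  (forall i x, 0 <= f i x) -> (forall i, measurable_fun setT (f i)) ->
  (forall i, measurable (B i)) ->
  (\int[lebesgue_tuple n]_(t in box B) (\prod_i f i (tnth t i))%:E =
   \prod_i \int[lebesgue_measure]_(x in B i) (f i x)%:E)%E.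
Proof.
move=> f0 mf mB; rewrite integral_mkcond.
transitivity (\int[lebesgue_tuple n]_t (\prod_i (f i \_ (B i)) (tnth t i))%:E)%E.
  apply: eq_integral => t _; rewrite patchE; case: ifPn => [|].
    rewrite inE => tB; congr (_%:E); apply: eq_bigr => i _.
    by rewrite patchE mem_set.
  rewrite notin_setE /= => /existsNP[i tB].
  by rewrite (bigD1 i)//= patchE memNset// mul0r.
rewrite (integral_prod_lebesgue_tuple (f := fun i => f i \_ (B i))).
- apply: eq_bigr => i _; rewrite [RHS]integral_mkcond.
  by apply: eq_integral => x _; rewrite restrict_EFin.
- by move=> i x; apply: restrict_ge0 => y _; exact: f0.
- move=> i; apply/(measurable_restrictT _ (mB i)).
  exact: measurable_funTS.
Qed.

End boxes.

(** * The law of a vector of independent variables *)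

Section independent_densities.
Context d {T : measurableType d} {R : realType} (Pr : probability T R).

Lemma measurable_random_vector n (X : 'I_n -> {RV Pr >-> R}) :
  measurable_fun setT (random_vector X).
Proof.
apply/measurable_fun_tnthP => i.
rewrite (_ : _ \o _ = X i); first exact: measurable_funPT.
by apply/funext => w /=; rewrite tnth_mktuple.
Qed.

Lemma independent_rvs_density n (X : 'I_n -> {RV Pr >-> R})
    (f : 'I_n -> R -> R) (B : set (n.-tuple R)) :
  (forall i x, 0 <= f i x) -> (forall i, measurable_fun setT (f i)) ->
  (forall i (C : set R), measurable C ->
    Pr (X i @^-1` C) = \int[lebesgue_measure]_(x in C) (f i x)%:E)%E ->
  independent_rvs X -> measurable B ->
  (Pr (random_vector X @^-1` B) =
    \int[lebesgue_tuple n]_(t in B) (\prod_i f i (tnth t i))%:E)%E.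
Proof.
move=> f0 mf Xf indX mB.
pose g (t : n.-tuple R) := (\prod_i f i (tnth t i))%:E.
have g0 t : (0 <= g t)%E by rewrite lee_fin prodr_ge0.
have mg : measurable_fun [set: n.-tuple R] g.
  apply/measurable_EFinP; apply: measurable_prod => i _.
  apply: (measurableT_comp (mf i)); exact: measurable_tnth.
pose m1 := pushforward_measure Pr (measurable_random_vector X).
(* The measure with density [g], to be identified with the law [m1] of the vector. *)
pose nu (C : set (n.-tuple R)) := (\int[lebesgue_tuple n]_(t in C) g t)%E.
have nu0 : nu set0 = 0%E by rewrite /nu integral_set0.
have nu_ge0 C : (0 <= nu C)%E by apply: integral_ge0 => t _.
have nuS : semi_sigma_additive nu by exact: semi_sigma_additive_nng_induced.
pose nuM := isMeasure.Build _ _ _ nu nu0 nu_ge0 nuS.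
pose m2 : {measure set (n.-tuple R) -> \bar R} := HB.pack nu nuM.
pose G := [set box B | B in [set B : 'I_n -> set R | forall i, measurable (B i)]].
suff : m1 B = m2 B by [].
(* Since [m1] is finite, the constant sequence [setT], itself a box, serves as the exhausting
   cover. *)
apply: (measure_unique G (fun=> setT)) => //.
- exact: tuple_measurableE.
- move=> _ _ [C mC <-] [D mD <-]; exists (fun i => C i `&` D i).
    by move=> i; exact: measurableI.
  apply/seteqP; split=> t /=.
    by move=> CD; split=> i; have [] := CD i.
  by move=> [Ct Dt] i; split; [exact: Ct|exact: Dt].
- by move=> _; exists (fun=> setT) => //; exact: boxT.
- exact: bigcup_const.
- move=> _ [C mC <-].
  transitivity (\prod_i Pr (X i @^-1` C i))%E.
    (* Independence is applied with [J] the full index set. *)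
    transitivity (\prod_(i in [set: 'I_n]%SET) Pr (X i @^-1` C i))%E; last first.
      by apply: eq_bigl => i; rewrite inE.
    rewrite -indX//; congr (Pr _); apply/seteqP; split=> w /=.
      by move=> Cw i _; have := Cw i; rewrite tnth_mktuple.
    by move=> Cw i; rewrite tnth_mktuple; apply: Cw; rewrite /= inE.
  rewrite /m2/= /nu integral_lebesgue_tuple_box//.
  by apply: eq_bigr => i _; exact: Xf.
- by move=> _; rewrite /m1/= /pushforward preimage_setT probability_setT ltry.
Qed.

End independent_densities.

Theorem theorem3p6 (R : realType) (n : nat) (A P : set 'rV[R]_n)
    (affA : affine_subspace A)
    (PE : P = A `&` nonneg_orthant n)
    (bndP : bounded_set P)
    (intP : exists x, P x /\ forall j, 0 < x ord0 j) :
  strictly_concave_on (pos_orthant n) (@entropy R n) /\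
  exists z : 'rV[R]_n,
    [/\ maximizers P (@entropy R n) = [set z],
        (forall j, 0 < z ord0 j) &
        forall (d : measure_display) (T : measurableType d)
            (Pr : probability T R) (X : 'I_n -> {RV Pr >-> R}),
          (forall j, exponential_rv (X j)) ->
          (forall j, 'E_Pr[X j] = (z ord0 j)%:E)%E ->
          independent_rvs X ->
          has_joint_density X (exponential_joint_pdf z) /\
          forall x, P x ->
            (exponential_joint_pdf z x)%:E = expeR (- entropy z)%E].
Proof.
subst P; split; first exact: strictly_concave_entropy.
have [z [zmax z0 xz]] := entropy_maximizer affA bndP intP.
exists z; split=> // d T Pr X expX EX indX; split; last first.
  by move=> x [Ax x0]; apply: exponential_joint_pdf_sum_ratio => //; exact: xz.
have pdf_ge0 j x : 0 <= exponential_pdf (z ord0 j)^-1 x.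
  by rewrite exponential_pdf_ge0// invr_ge0 ltW// z0.
have pdfE (t : n.-tuple R) : exponential_joint_pdf z (\row_j tnth t j) =
    \prod_j exponential_pdf (z ord0 j)^-1 (tnth t j).
  by apply: eq_bigr => j _; rewrite mxE.
split=> [x||B mB].
- exact: prodr_ge0.
- under eq_fun do rewrite pdfE; apply: measurable_prod => j _.
  apply: (measurableT_comp (measurable_exponential_pdf _)).
  exact: measurable_tnth.
- under eq_integral do rewrite pdfE.
  apply: (independent_rvs_density
    (f := fun j => exponential_pdf (z ord0 j)^-1)) => //.
    by move=> j; exact: measurable_exponential_pdf.
  (* The scale [zeta] of [X j] is its expectation, which is [z ord0 j] by [EX]. *)
  move=> j C mC; have [zeta zeta0 Xj] := expX j.
  have := EX j; rewrite (expectation_exponential zeta0 Xj) => -[<-].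
  exact: Xj.
Qed.
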